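(* For $n\ge1$, the unreduced Euler characteristic of $\mathrm{Hom}(B_n)$ is $$\chi_n=\sum_{k=0}^{\lfloor n/2\rfloor}(-1)^k\frac{n!}{2^k}\binom{n-k}{k}.$$
   Context: $B_n$ is the Boolean lattice of subsets of $\{1,\ldots,n\}$, graded of rank $n$; $C_n$ is the chain $0<1<\cdots<n$. $\mathrm{Hom}(B_n)=\mathrm{Hom}(C_n,B_n)$ is the subcomplex of the product of simplices $\prod_{p=0}^n\Delta_{B_n}$ whose cells are the tuples $(X_0,\ldots,X_n)$ of nonempty subsets of $B_n$ such that every map $\eta$ with $\eta(p)\in X_p$ is strictly order-preserving from $C_n$ to $B_n$ (the cell being the product of simplices $\Delta_{X_p}$); its vertices are the maximal chains of $B_n$, i.e. permutations of $\{1,\ldots,n\}$. *)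

(* Defs.v *)
From HB Require Import structures.
From mathcomp Require Import all_boot all_order all_algebra.
Set Implicit Arguments. Unset Strict Implicit. Unset Printing Implicit Defensive.
Import Order.TTheory GRing.Theory Num.Theory.
Import Order.DefaultSetSubsetOrder.

Section HomComplex.
Context {dP dQ : Order.disp_t} (P : finPOrderType dP) (Q : finPOrderType dQ).

Definition strictly_order_preserving (eta : P -> Q) : bool :=
  [forall p, forall q, (p < q)%O ==> (eta p < eta q)%O].

(* Nonempty subsets of Q are the (nonempty) faces of the full simplex on Q, so
   tuples of nonempty subsets indexed by P are the cells of the product of
   simplices $\prod_{p \in P} \Delta_Q$. *)
Definition prod_simplex_cell (X : {ffun P -> {set Q}}) : bool :=
  [forall p, X p != set0].

Definition Hom_complex : {set {ffun P -> {set Q}}} :=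
  [set X | prod_simplex_cell X &
    [forall eta : {ffun P -> Q},
       [forall p, eta p \in X p] ==> strictly_order_preserving eta]].

(* A product of simplices of dimensions #|X p| - 1. *)
Definition cell_dim (X : {ffun P -> {set Q}}) : nat := (\sum_p (#|X p|).-1)%N.

(* Unreduced: the empty cell does not occur in Hom_complex and is not counted. *)
Definition euler_char (K : {set {ffun P -> {set Q}}}) : int :=
  (\sum_(X in K) (-1) ^+ cell_dim X)%R.

End HomComplex.

Arguments Hom_complex {dP dQ} P Q.

Definition chain_poset (n : nat) := Order.FinPOrder.clone _ 'I_n.+1 _.

(* Subsets of 'I_n = {0, ..., n-1}, in place of {1, ..., n}, under the inclusion
   order of Order.DefaultSetSubsetOrder. *)
Definition boolean_lattice (n : nat) := Order.FinPOrder.clone _ {set 'I_n} _.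

Definition HomB (n : nat) := Hom_complex (chain_poset n) (boolean_lattice n).

(* Main.v *)
Require Import Defs.
From HB Require Import structures.
From mathcomp Require Import all_boot all_order all_algebra.
From mathcomp Require Import ring.
Set Implicit Arguments. Unset Strict Implicit. Unset Printing Implicit Defensive.
Import Order.TTheory GRing.Theory Num.Theory.
Local Open Scope ring_scope.

(** A cell of Hom(C_n, Q) is a tuple of nonempty sets X_0, ..., X_n in which
    every element of X_i lies below every element of X_(i+1), so the signed count
    of cells is a transfer sum W p Y, the signed count of the tuples
    (X_0, ..., X_p) with X_p = Y.  In the Boolean lattice W p Y vanishes unless all
    members of Y have at least p elements.  If #|B| = p + 1, the sets X_p allowed
    below {B} are therefore {B :\ b | b in S} for S a nonempty subset of B, and
    what lies below such an X_p is contained in B :\: S.  A set X_(p-1) can exist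
    there only if #|S| <= 2, and it equals {B :\: S} if #|S| = 2.  Hence
    w p = W p {B} with #|B| = p satisfies
    w (p+2) = (p+2) w (p+1) - 'C(p+2, 2) w p,
    which is Pascal's rule for the closed form. *)

(** * Weighted sums over chains of a relation, computed by a transfer recursion *)

Section ChainSum.
Variables (S : finType) (R : comPzRingType) (a : S -> R) (r : rel S).

Definition r_chain n (X : {ffun 'I_n.+1 -> S}) : bool :=
  [forall i : 'I_n, r (X (inord i)) (X (inord i.+1))].

Fixpoint chain_sum (n : nat) (y : S) : R :=
  if n is m.+1 then a y * \sum_(z | r z y) chain_sum m z else a y.

Let extend n (y : S) (X : {ffun 'I_n.+1 -> S}) : {ffun 'I_n.+2 -> S} :=
  [ffun i => oapp X y (unlift ord_max i)].

Let extend_lift n y (X : {ffun 'I_n.+1 -> S}) (i : 'I_n.+1) :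
  extend y X (lift ord_max i) = X i.
Proof. by rewrite ffunE liftK. Qed.

Let extend_max n y (X : {ffun 'I_n.+1 -> S}) : extend y X ord_max = y.
Proof. by rewrite ffunE unlift_none. Qed.

Let inord_lift n i : (i < n.+1)%N ->
  inord i = lift ord_max (inord i : 'I_n.+1) :> 'I_n.+2.
Proof.
by move=> lt_in; apply/val_inj; rewrite [RHS]lift_max /= !inordK // ltnS ltnW.
Qed.

Let r_chain_extend n y (X : {ffun 'I_n.+1 -> S}) :
  r_chain (extend y X) = r_chain X && r (X ord_max) y.
Proof.
have inord_max : inord n.+1 = ord_max :> 'I_n.+2.
  by apply/val_inj; rewrite /= inordK.
have inord_max' : inord n = ord_max :> 'I_n.+1.
  by apply/val_inj; rewrite /= inordK.
apply/forallP/andP => [rX | [/forallP rX rXy] i].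
  split; last first.
    have := rX ord_max; rewrite /= inord_max extend_max inord_lift //.
    by rewrite extend_lift inord_max'.
  apply/forallP=> i; have := rX (widen_ord (leqnSn n) i).
  have lt_in := ltn_ord i.
  by rewrite /= (inord_lift (leqW lt_in)) (@inord_lift _ i.+1) // !extend_lift.
have [lt_in | ] := ltnP i n.
  rewrite inord_lift // inord_lift // !extend_lift.
  exact: (rX (Ordinal lt_in)).
rewrite leq_eqVlt ltnNge -ltnS ltn_ord orbF => /eqP<-.
by rewrite inord_max extend_max inord_lift // extend_lift inord_max'.
Qed.

(** Deleting the last entry [y] of a chain leaves a shorter chain whose own last entry [z] satisfies
    [r z y]; grouping by [z] gives the recursion. *)
Lemma sum_r_chain_max n y :
  \sum_(X : {ffun 'I_n.+1 -> S} | (X ord_max == y) && r_chain X)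
     \prod_i a (X i) = chain_sum n y.
Proof.
elim: n y => [|n IHn] y.
  rewrite (big_pred1 [ffun=> y]) => [|X /=].
    by rewrite big_ord1 ffunE.
  apply/andP/eqP => [[/eqP Xy _] | ->].
    by apply/ffunP=> i; rewrite ffunE -Xy ord1 [ord_max]ord1.
  by rewrite ffunE; split=> //; apply/forallP; case.
(* Chains ending in [y] are parametrised by their truncations, with [extend y] as the inverse of
   truncation. *)
rewrite (reindex_onto (@extend n y) (fun X => [ffun i => X (lift ord_max i)])).
  rewrite /= mulr_sumr.
  under eq_bigl => X.
    rewrite extend_max eqxx r_chain_extend /=.
    have -> : [ffun i => extend y X (lift ord_max i)] == X.
      by apply/eqP/ffunP=> i; rewrite ffunE extend_lift.
    rewrite andbT; over.
  rewrite (partition_big (fun X : {ffun _} => X ord_max) (r^~ y)) /=; last first.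
    by move=> X /andP[].
  apply: eq_bigr => z rzy; rewrite -IHn mulr_sumr; apply: eq_big => X.
    by case: eqP => [->|_]; rewrite ?rzy ?andbT ?andbF.
  move=> _; rewrite big_ord_recr /= extend_max mulrC; congr (_ * _).
  apply: eq_bigr => i _; rewrite -(extend_lift y X i); congr (a (extend _ _ _)).
  by apply/val_inj; rewrite [RHS]lift_max.
move=> X /andP[/eqP Xy _]; apply/ffunP=> i; rewrite ffunE.
by case: unliftP => [j|] -> //=; rewrite ffunE.
Qed.

Lemma sum_r_chain n :
  \sum_(X : {ffun 'I_n.+1 -> S} | r_chain X) \prod_i a (X i) =
  \sum_y chain_sum n y.
Proof.
rewrite (partition_big (fun X : {ffun _} => X ord_max) predT) //=.
apply: eq_bigr => y _; rewrite -sum_r_chain_max.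
by apply: eq_bigl => X; rewrite andbC.
Qed.

End ChainSum.

(** * Cells of a Hom complex out of a chain *)

Section HomChain.
Context {d : Order.disp_t} (Q : finPOrderType d).

Definition set_lt : rel {set Q} :=
  fun Z Y => [forall z in Z, forall y in Y, (z < y)%O].

Lemma set_ltP (Z Y : {set Q}) :
  reflect {in Z & Y, forall z y, (z < y)%O} (set_lt Z Y).
Proof.
apply: (iffP forall_inP) => [lt_ZY z y zZ yY | lt_ZY z zZ].
  by have /forall_inP := lt_ZY z zZ; apply.
by apply/forall_inP => y; apply: lt_ZY.
Qed.

(** The value 0 at the empty set discards tuples that are not cells: [set_lt] holds vacuously next
    to an empty set and would not exclude them. *)
Definition simplex_sign (Y : {set Q}) : int :=
  if Y == set0 then 0 else (-1) ^+ (#|Y|).-1.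

(** The entries of a selection vary independently, so all selections are increasing exactly when any
    two elements of consecutive sets compare; transitivity handles distant indices. *)
Lemma mem_Hom_chain n (X : {ffun chain_poset n -> {set Q}}) :
  (X \in Hom_complex (chain_poset n) Q) =
  [forall p, X p != set0] && r_chain set_lt X.
Proof.
rewrite inE /prod_simplex_cell; case: forallP => //= X_neq0.
apply/forallP/forallP => [etaX i | ltX eta].
  apply/set_ltP => z y zX yX.
  have ex_eta p : exists x, x \in X p by apply/set0Pn.
  (* A selection through the prescribed [z] and [y]; nonemptiness of the sets supplies its other
     values. *)
  pose eta := [ffun p : chain_poset n => if p == inord i then z
    else if p == inord i.+1 then y else xchoose (ex_eta p)].
  have lt_i : (i < n.+1)%N by rewrite ltnS ltnW.
  have lt_i1 : (i.+1 < n.+1)%N by rewrite ltnS.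
  have eta_i : eta (inord i) = z by rewrite ffunE eqxx.
  have eta_i1 : eta (inord i.+1) = y.
    rewrite ffunE eqxx ifN // -val_eqE /= !inordK //.
    by rewrite neq_ltn ltnSn orbT.
  have /forallP/(_ (inord i))/forallP/(_ (inord i.+1)) :
      strictly_order_preserving eta.
    apply: (implyP (etaX eta)); apply/forallP=> p; rewrite ffunE.
    case: eqP => [-> //|_]; case: eqP => [-> //|_].
    exact: xchooseP.
  by rewrite eta_i eta_i1 ltEord !inordK // ltnSn.
apply/implyP=> /forallP etaX; apply/forallP=> p; apply/forallP=> q.
apply/implyP; rewrite ltEord => lt_pq.
(* Induction on the gap between [p] and [q], composing comparisons of neighbours. *)
have [k] : {k | q = (p + k.+1)%N :> nat}.
  by exists (q - p.+1)%N; rewrite addnS -addSn subnKC.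
elim: k q {lt_pq} => [|k IHk] q def_q.
  have lt_pn : (p < n)%N by rewrite -ltnS (leq_trans _ (ltn_ord q)) // def_q addn1.
  have /set_ltP := ltX (Ordinal lt_pn); apply.
    by rewrite inord_val.
  have /= -> : inord p.+1 = q; last exact: etaX.
  by apply/val_inj; rewrite /= -[p.+1]addn1 -def_q inord_val.
have lt_n : (p + k.+1 < n)%N by rewrite -ltnS (leq_trans _ (ltn_ord q)) // def_q !addnS.
have lt_n1 : (p + k.+1 < n.+1)%N by rewrite ltnW.
apply: (lt_trans (IHk (inord (p + k.+1)) _)); first by rewrite /= inordK.
have /set_ltP := ltX (Ordinal lt_n); apply; first exact: etaX.
have /= -> : inord (p + k.+1).+1 = q; last exact: etaX.
by apply/val_inj; rewrite /= -addnS -def_q inord_val.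
Qed.

Lemma euler_char_Hom_chain n :
  euler_char (Hom_complex (chain_poset n) Q) =
  \sum_Y chain_sum simplex_sign set_lt n Y.
Proof.
rewrite /euler_char -sum_r_chain.
(* Tuples with an empty entry have a zero factor; on the others the product of signs is the sign of
   the cell dimension. *)
rewrite [RHS](bigID (fun X : {ffun 'I_n.+1 -> {set Q}} => [forall p, X p != set0])) /=.
rewrite [X in _ = _ + X]big1 ?addr0 => [|X /andP[_]].
  apply: eq_big => [X|X]; first by rewrite mem_Hom_chain andbC.
  rewrite mem_Hom_chain => /andP[/forallP X_neq0 _].
  rewrite /cell_dim expr_sum; apply: eq_bigr => p _.
  by rewrite /simplex_sign (negPf (X_neq0 p)).
rewrite negb_forall => /existsP[p]; rewrite negbK => Xp0.
by rewrite (bigD1 p) //= /simplex_sign Xp0 mul0r.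
Qed.

End HomChain.

(** * The recurrence satisfied by the closed form *)

Section ClosedForm.

Definition euler_formula (n : nat) : rat :=
  \sum_(0 <= k < (n %/ 2).+1)
    (-1) ^+ k * ((n`!)%:R / 2%:R ^+ k) * ('C(n - k, k))%:R.

Let weighted_bin (n k : nat) : rat := (- 2%:R^-1) ^+ k * ('C(n - k, k))%:R.

Let bin_diag0 n k : (n %/ 2 < k)%N -> 'C(n - k, k) = 0%N.
Proof.
move=> lt_k; apply: bin_small; rewrite ltn_psubLR ?(leq_trans _ lt_k) //.
by rewrite addnn -muln2 -ltn_divLR.
Qed.

(** The binomials vanish beyond [n %/ 2], so the range can be lengthened at will; this lets sums for
    different [n] be compared termwise. *)
Let euler_formulaE n m : (n %/ 2 < m)%N ->
  euler_formula n = (n`!)%:R * \sum_(0 <= k < m) weighted_bin n k.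
Proof.
move=> lt_m; rewrite (big_cat_nat (leq0n (n %/ 2).+1)) //=.
rewrite [X in _ + X]big_nat_cond [X in _ + X]big1 ?addr0; last first.
  move=> k /andP[/andP[lt_k _] _].
  by rewrite /weighted_bin bin_diag0 // mulr0.
rewrite mulr_sumr; apply: eq_bigr => k _.
by rewrite /weighted_bin [(- 2%:R^-1) ^+ k]exprNn exprVn; ring.
Qed.

Lemma euler_formula0 : euler_formula 0 = 1.
Proof. by rewrite /euler_formula big_nat1 expr0 bin0 divr1 !mulr1. Qed.

Lemma euler_formula1 : euler_formula 1 = 1.
Proof. by rewrite /euler_formula big_nat1 expr0 bin0 divr1 !mulr1. Qed.

Lemma euler_formulaSS n :
  euler_formula n.+2 =
    n.+2%:R * euler_formula n.+1
    - ('C(n.+2, 2))%:R * euler_formula n.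
Proof.
have le_div j : (j %/ 2 <= j)%N by exact: leq_div.
(* The sum for [n] gets one term fewer because its index [j] will be matched with [j.+1] in the
   other two. *)
rewrite (@euler_formulaE n.+2 n.+3) ?(@euler_formulaE n.+1 n.+3);
  rewrite ?(@euler_formulaE n n.+2) ?ltnS ?leq_div //; last first.
- by rewrite (leq_trans (le_div n.+1)).
- by rewrite (leq_trans (le_div n)).
have bin2E : ('C(n.+2, 2))%:R * (n`!)%:R = (n.+2`!)%:R / 2%:R :> rat.
  rewrite -[X in X%:R / _](@bin_fact n.+2 2) // !subSS subn0 !natrM.
  by field.
rewrite mulrA -natrM -factS mulrA bin2E -!mulrA -mulrBr; congr (_ * _).
rewrite [LHS]big_nat_recl // [X in X - _]big_nat_recl //.
rewrite mulr_sumr /weighted_bin !expr0 !subn0 !bin0 -addrA; congr (_ + _).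
rewrite -sumrB; apply: eq_big_nat => j /andP[_ lt_j].
(* Pascal's rule; at [j = n.+1] the subtractions truncate to 0 and all three binomials vanish. *)
have -> : 'C(n.+2 - j.+1, j.+1) = ('C(n.+1 - j.+1, j.+1) + 'C(n - j, j))%N.
  rewrite !subSS; have [le_jn | lt_nj] := leqP j n.
    by rewrite subSn // binS.
  rewrite (eqP (lt_nj : n.+1 - j == 0)%N) (eqP (ltnW lt_nj : n - j == 0)%N).
  by rewrite !bin0n; case: j lt_nj {lt_j}.
by rewrite natrD exprS; ring.
Qed.

End ClosedForm.

(** * Transfer sums in the Boolean lattice *)

Section BooleanLattice.
Variable n : nat.
Implicit Types (A B S : {set 'I_n}) (Y Z : {set boolean_lattice n}).

Definition cell_sum := chain_sum (@simplex_sign _ (boolean_lattice n)) (@set_lt _ _).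

Definition codim1 B S : {set boolean_lattice n} := [set B :\ b | b in S].

Lemma ltEproper (A B : boolean_lattice n) : (A < B)%O = (A \proper B).
Proof. by rewrite lt_neqAle Order.SetSubsetOrder.leEsubset properEneq. Qed.

(** A nonzero sum has a nonzero term, hence a nonempty set below [Y], and cardinality rises by at
    least one at each strict inclusion. *)
Lemma cell_sum_neq0 p Y :
  cell_sum p Y != 0 -> Y != set0 /\ {in Y, forall A : {set 'I_n}, (p <= #|A|)%N}.
Proof.
elim: p Y => [|p IHp] Y.
  by rewrite /= /simplex_sign; case: (Y =P set0); rewrite ?eqxx.
rewrite /= mulf_eq0 negb_or => /andP[signY sumY]; split.
  by apply: contraNneq signY => ->; rewrite /simplex_sign eqxx.
move=> A AY; rewrite ltnNge; apply: contraNN sumY => leAp.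
apply/eqP/big1 => Z /set_ltP ltZY; apply/eqP/negP => /negP/IHp[].
case/set0Pn=> z zZ /(_ z zZ); apply/negP; rewrite -ltnNge.
by apply: leq_trans (proper_card _) leAp; rewrite -ltEproper ltZY.
Qed.

Lemma codim1_inj B : {in B &, injective (fun b => B :\ b)}.
Proof.
move=> a b aB bB /setP/(_ a); rewrite !inE eqxx aB andbT /=.
by case: eqP.
Qed.

Lemma codim1_set_inj B : {in powerset B &, injective (codim1 B)}.
Proof.
move=> S S'; rewrite !powersetE => sSB sS'B eqS; apply/setP=> a.
have [aB | aNB] := boolP (a \in B); last first.
  by rewrite (contraNF (subsetP sSB a)) ?(contraNF (subsetP sS'B a)).
have mem_codim1 (U : {set 'I_n}) : U \subset B -> (a \in U) = (B :\ a \in codim1 B U).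
  move=> sUB; apply/idP/imsetP => [aU | [b bU eq_ab]]; first by exists a.
  by rewrite (codim1_inj aB (subsetP sUB b bU) eq_ab).
by rewrite !mem_codim1 ?eqS.
Qed.

(** A contributing set has members strictly inside [B] with at least [p] elements, so each omits
    exactly one element of [B]. The term of the empty [S] is harmless, its sign being 0. *)
Lemma cell_sum1S p B : #|B| = p.+1 ->
  cell_sum p.+1 [set B : boolean_lattice n] =
  \sum_(S in powerset B) cell_sum p (codim1 B S).
Proof.
move=> cardB; rewrite /= /simplex_sign -cards_eq0 cards1 expr0 mul1r.
rewrite (bigID (mem (codim1 B @: powerset B))) /= -/cell_sum.
rewrite [X in _ + X]big1 ?addr0 => [|Z /andP[/set_ltP ltZ]].
  rewrite -(big_imset _ (@codim1_set_inj B)).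
  apply: eq_bigl => Z; apply/andb_idl => /imsetP[S].
  rewrite powersetE => /subsetP sSB ->; apply/set_ltP => _ y /imsetP[b bS ->].
  by rewrite inE => /eqP->; rewrite ltEproper properD1 ?sSB.
apply: contraNeq => /cell_sum_neq0[_ cardZ].
have ZB z : z \in Z -> exists2 b, b \in B & z = B :\ b.
  move=> zZ; have: z \proper B by rewrite -ltEproper ltZ ?inE.
  rewrite properE => /andP[szB /subsetPn[b bB bNz]]; exists b => //.
  apply/eqP; rewrite eqEcard subsetD1 szB bNz /=.
  by have := cardsD1 b B; rewrite bB cardB add1n => -[<-]; apply: cardZ.
apply/imsetP; exists [set b in B | B :\ b \in Z].
  by rewrite powersetE; apply/subsetP=> b; rewrite inE => /andP[].
apply/setP=> z; apply/idP/imsetP => [zZ | [b + ->]]; last by rewrite inE => /andP[].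
by have [b bB zb] := ZB z zZ; exists b => //; rewrite inE bB -zb.
Qed.

(** A singleton [S] is left alone, since [codim1 B S] is then already of the form [[set B :\ b]].
    Otherwise whatever lies below is contained in every [B :\ b] with [b] in [S], hence in
    [B :\: S]. *)
Lemma cell_sum_codim1 p B S : #|B| = p.+2 -> S \subset B ->
  cell_sum p.+1 (codim1 B S) =
  (if #|S| == 1 then cell_sum p.+1 (codim1 B S) else 0)
  - (if #|S| == 2 then cell_sum p [set B :\: S : boolean_lattice n] else 0).
Proof.
move=> cardB sSB; case: eqP => [-> | /eqP S1]; first by rewrite subr0.
have [S0 | S_gt0] := posnP #|S|.
  rewrite S0 /= subr0; move/cards0_eq: S0 => ->.
  by rewrite /codim1 imset0 /simplex_sign eqxx mul0r.
have S_ge2 : (2 <= #|S|)%N by case: #|S| S1 S_gt0 => [|[]].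
have cardBS : #|B :\: S| = (p.+2 - #|S|)%N.
  by rewrite cardsD (setIidPr sSB) cardB.
have ltZ Z z : set_lt Z (codim1 B S) -> z \in Z -> z \subset B :\: S.
  move=> /set_ltP ltZ zZ; have ltz b : b \in S -> z \subset B :\ b.
    by move=> bS; rewrite proper_sub // -ltEproper ltZ //; apply: imset_f.
  rewrite subsetD; apply/andP; split.
    have /card_gt0P[b bS] := S_gt0.
    by apply: subset_trans (ltz b bS) _; rewrite subD1set.
  rewrite disjoint_sym disjoints_subset; apply/subsetP=> b /ltz.
  by rewrite subsetD1 inE => /andP[].
rewrite sub0r /=; case: eqP => [S2 | /eqP S2]; last first.
  (* With more than two elements removed, [B :\: S] has fewer than [p] elements, too few for a
     nonzero term. *)
  rewrite big1 ?mulr0 ?oppr0 // => Z ltZS; apply/eqP/negPn/negP.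
  case/cell_sum_neq0=> /set0Pn[z zZ] /(_ z zZ).
  apply/negP; rewrite -ltnNge.
  apply: leq_ltn_trans (subset_leq_card (ltZ Z z ltZS zZ)) _.
  rewrite cardBS ltn_subLR -?cardB ?subset_leq_card // cardB.
  by rewrite -[p.+2]add2n ltn_add2r ltn_neqAle eq_sym S2.
have sign_codim1 : simplex_sign (codim1 B S) = -1.
  rewrite /simplex_sign -cards_eq0 card_in_imset ?S2 //.
  by move=> a b /(subsetP sSB) aB /(subsetP sSB) bB; apply: codim1_inj.
rewrite sign_codim1 mulN1r; congr (- _).
(* Here [B :\: S] has exactly [p] elements, so it is the only possible member of a contributing
   [Z]. *)
rewrite (bigD1 [set B :\: S : boolean_lattice n]) /=; last first.
  apply/set_ltP => z y; rewrite inE => /eqP-> /imsetP[b bS ->].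
  have bB := subsetP sSB b bS.
  rewrite ltEproper properEcard setDS ?sub1set //= cardBS S2.
  by have := cardsD1 b B; rewrite bB cardB add1n => -[<-]; rewrite !subSS subn0.
rewrite -/cell_sum big1 ?addr0 // => Z /andP[ltZS]; apply: contraNeq.
case/cell_sum_neq0=> /set0Pn[z zZ] cardZ.
have Z_eq z' : z' \in Z -> z' = B :\: S.
  move=> z'Z; apply/eqP; rewrite eqEcard (ltZ Z) //=.
  by rewrite cardBS S2 !subSS subn0 cardZ.
apply/eqP/setP=> z'; rewrite inE; apply/idP/eqP => [/Z_eq //|->].
by rewrite -(Z_eq z zZ).
Qed.

Lemma cell_sum1_rec p B : #|B| = p.+2 ->
  cell_sum p.+2 [set B : boolean_lattice n] =
    \sum_(S : {set 'I_n} | (S \subset B) && (#|S| == 1))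
      cell_sum p.+1 [set B :\: S : boolean_lattice n]
    - \sum_(S : {set 'I_n} | (S \subset B) && (#|S| == 2))
        cell_sum p [set B :\: S : boolean_lattice n].
Proof.
move=> cardB; rewrite cell_sum1S //.
rewrite (eq_bigl (fun S => S \subset B)) => [|S]; last by rewrite powersetE.
rewrite (eq_bigr _ (fun S => @cell_sum_codim1 p B S cardB)).
rewrite big_split /= sumrN -!big_mkcondr /=; congr (_ - _).
by apply: eq_bigr => S /andP[_ /cards1P[b ->]]; rewrite /codim1 imset_set1.
Qed.

(** Strong induction, as the recurrence reaches back two steps; the factors [p.+2] and ['C(p.+2, 2)]
    count the one- and two-element subsets of [B]. *)
Lemma cell_sum1 p B : #|B| = p ->
  (cell_sum p [set B : boolean_lattice n])%:~R = euler_formula p.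
Proof.
have [m lt_pm] := ubnP p.
elim: m p B lt_pm => // m IHm [|[|p]] B; rewrite ltnS => le_pm cardB.
- by rewrite /= /simplex_sign -cards_eq0 cards1 euler_formula0.
- rewrite cell_sum1S // euler_formula1 /=.
  rewrite (bigD1 B) ?powersetE //= big1 => [|S /andP[]]; last first.
    rewrite powersetE => sSB S_neqB; have : #|S| = 0.
      have: S \proper B by rewrite properEneq S_neqB.
      by move/proper_card; rewrite cardB; case: #|S|.
    by move=> /cards0_eq->; rewrite /codim1 imset0 /simplex_sign eqxx.
  have /eqP/cards1P[b ->] := cardB.
  by rewrite /codim1 imset_set1 /simplex_sign -cards_eq0 cards1.
have cardBS S k : (S \subset B) && (#|S| == k) -> #|B :\: S| = (p.+2 - k)%N.
  by case/andP=> sSB /eqP<-; rewrite cardsD (setIidPr sSB) cardB.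
have cardS k :
    #|[pred S : {set 'I_n} | (S \subset B) && (#|S| == k)]| = 'C(p.+2, k).
  by rewrite -cardB -cards_draws cardsE.
rewrite cell_sum1_rec // rmorphB !rmorph_sum euler_formulaSS.
congr (_ - _).
  rewrite (eq_bigr (fun=> euler_formula p.+1)) => [|S SB].
    by rewrite sumr_const cardS bin1 mulr_natl.
  by apply: IHm; rewrite ?(cardBS S 1) // subn1.
rewrite (eq_bigr (fun=> euler_formula p)) => [|S SB].
  by rewrite sumr_const cardS mulr_natl.
by apply: IHm; [rewrite ltnW | rewrite (cardBS S 2)// !subSS subn0].
Qed.

(** In the top position a contributing set has only members with at least [n] elements, so it
    consists of the full set alone. *)
Lemma euler_char_HomB :
  (euler_char (HomB n))%:~R = euler_formula n.
Proof.
rewrite euler_char_Hom_chain -(@cell_sum1 n setT) ?cardsT ?card_ord //.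
rewrite (bigD1 [set setT : boolean_lattice n]) //= big1 ?addr0 // => Y.
apply: contraNeq => /cell_sum_neq0[/set0Pn[A0 A0Y] cardY].
have Y_full A : A \in Y -> A = setT.
  by move=> AY; apply/eqP; rewrite eqEcard subsetT cardsT card_ord cardY.
apply/eqP/setP=> A; rewrite inE; apply/idP/eqP => [/Y_full //|->].
by rewrite -(Y_full A0 A0Y).
Qed.

End BooleanLattice.

Theorem theorem6p2 (n : nat) (hn : (1 <= n)%N) :
  (euler_char (HomB n))%:~R =
    \sum_(0 <= k < (n %/ 2).+1)
      (-1) ^+ k * ((n`!)%:R / 2%:R ^+ k) * ('C(n - k, k))%:R :> rat.
Proof. exact: euler_char_HomB. Qed.
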